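(* Let $T>0$, $\mathbf{y}_0\in\mathbb{R}^N$, and let $\mathbf{F}:[0,T]\times\mathbb{R}^N\to\mathbb{R}^N$ be Borel measurable, continuous in the second argument, and map bounded sets to bounded sets. Assume that for every tolerance $\mathcal{E}>0$ there exists a quadrature $I_{\mathcal{E}}$ for $\mathbf{F}$ satisfying $\big|I_{\mathcal{E}}[\mathbf{F}(\cdot,\boldsymbol{\eta}(\cdot));a,b]-\int_a^b\mathbf{F}(s,\boldsymbol{\eta}(s))\,ds\big|\le\mathcal{E}$ for each network $\boldsymbol{\eta}$ with an architecture of type (A) and all $0\le a\le b\le T$. Let $(\epsilon_n)$ be a sequence of positive numbers converging to $0$, $R>0$, and let $\mathrm{Loss}_n$ be the loss functions defined in the context. Then every sequence $(\boldsymbol{\eta}_n)_{n\in\mathbb{N}}$ of networks with architectures of type (A) satisfying $\mathrm{Loss}_n(\boldsymbol{\eta}_n)\to0$ as $n\to\infty$ has a subsequence which converges in $L^1([0,T])$ to some $\mathbf{y}\in W^{1,1}([0,T];\mathbb{R}^N)$ satisfying $$\mathbf{y}(t)=\int_{[0,t]}\mathbf{F}(s,\mathbf{y}(s))\,ds+\mathbf{y}_0\qquad\text{for all }t\in[0,T].$$ In particular, if there exists only one such solution $\mathbf{y}$ on $[0,T]$, then $\boldsymbol{\eta}_n\to\mathbf{y}$ in $L^1([0,T])$.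
   Context: A network with architecture of type (A) (here with input dimension $d=1$ and output dimension $N$), with $L$ hidden layers and nondecreasing activation function $\sigma:\mathbb{R}\to\mathbb{R}$, is a map $\boldsymbol{\eta}(z)=\sum_{i=1}^K\eta_i(\mathbf{s}_i\odot z)$ with $\mathbf{s}_i\in\{-1,1\}^d$, $\odot$ componentwise multiplication, and $\eta_i(z)=A_{L+1,i}\hat\sigma(A_{L,i}\hat\sigma(\cdots\hat\sigma(A_{1,i}z+b_{1,i})\cdots)+b_{L,i})+b_{L+1,i}$, where $\hat\sigma$ is $\sigma$ applied componentwise, all matrices $A_{l,i}$ ($l=1,\dots,L+1$) have nonnegative real entries and, together with the real vectors $b_{l,i}$, compatible sizes. Its estimated M-variation is the vector $\operatorname{EMVar}(\boldsymbol{\eta};U)=\sum_{i=1}^K(\sup_{z\in U}\eta_i(\mathbf{s}_i\odot z)-\inf_{z\in U}\eta_i(\mathbf{s}_i\odot z))$, with sup and inf taken componentwise. For a network $\boldsymbol{\eta}$ and $n\in\mathbb{N}$ let $0=t_0<t_1<\dots<t_{K_t}=T$ be a partition (depending on $\boldsymbol{\eta}$ and $\epsilon_n$) such that for all $k$: $\operatorname{EMVar}(\boldsymbol{\eta};[t_{k-1},t_k])\le\epsilon_n$ (in each component), and $\int_{t_{k-1}}^{t_k}|\mathbf{F}(s,\boldsymbol{\eta}(s))|\,ds\le\epsilon_n$ or $t_k-t_{k-1}\le\epsilon_n$. The loss is $$\mathrm{Loss}_n(\boldsymbol{\eta})=\sum_{k=1}^{K_t}\big|\boldsymbol{\eta}(t_k)-\boldsymbol{\eta}(t_{k-1})-I_{\epsilon_n/K_t}[\mathbf{F}(\cdot,\boldsymbol{\eta}(\cdot));t_{k-1},t_k]\big|+|\boldsymbol{\eta}(0)-\mathbf{y}_0|+\max\{0,\,|\operatorname{EMVar}(\boldsymbol{\eta};[0,T])|-R\}.$$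 $|\cdot|$ is the Euclidean norm on $\mathbb{R}^N$. *)

(* Defs.v *)
From HB Require Import structures.
From mathcomp Require Import all_boot all_order all_algebra.
From mathcomp Require Import all_classical all_reals all_analysis.

Set Implicit Arguments.
Unset Strict Implicit.
Unset Printing Implicit Defensive.

Import Order.TTheory GRing.Theory Num.Theory.
Import numFieldNormedType.Exports.

Local Open Scope classical_set_scope.
Local Open Scope ring_scope.

Definition enorm (R : realType) (n : nat) (v : 'cV[R]_n) : R :=
  Num.sqrt (\sum_i v i ord0 ^+ 2).

(* [subnet R n L m] is a chain of [L] hidden layers followed by an affine output
   layer, with input dimension [m] and output dimension [n]; the widths of the
   hidden layers are unconstrained. *)
Inductive subnet (R : realType) (n : nat) : nat -> nat -> Type :=
| OutputLayer (m : nat) (A : 'M[R]_(n, m)) (b : 'cV[R]_n) : subnet R n 0 m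
| HiddenLayer (L m p : nat) (A : 'M[R]_(p, m)) (b : 'cV[R]_p)
    (f : subnet R n L p) : subnet R n L.+1 m.

Fixpoint subnet_eval (R : realType) (n : nat) (sigma : R -> R) (L m : nat)
    (f : subnet R n L m) : 'cV[R]_m -> 'cV[R]_n :=
  match f with
  | OutputLayer _ A b => fun z => A *m z + b
  | HiddenLayer _ _ _ A b g =>
      fun z => subnet_eval sigma g (map_mx sigma (A *m z + b))
  end.

Fixpoint subnet_nneg (R : realType) (n L m : nat) (f : subnet R n L m) : Prop :=
  match f with
  | OutputLayer _ A _ => forall i j, 0 <= A i j
  | HiddenLayer _ _ _ A _ g => (forall i j, 0 <= A i j) /\ subnet_nneg g
  end.

(* Networks of type (A) with input dimension 1.  The sign s_i is
   [(-1) ^+ net_sign i].  The structure records the parameters, not just the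
   realized map, because the estimated M-variation depends on them. *)
Record networkA (R : realType) (N : nat) := NetworkA {
  net_depth : nat;
  net_act : R -> R;
  net_act_nondecreasing : {homo net_act : x y / x <= y};
  net_size : nat;
  net_sign : 'I_net_size -> bool;
  net_subnet : 'I_net_size -> subnet R N net_depth 1;
  net_subnet_nneg : forall i, subnet_nneg (net_subnet i)
}.

Definition net_summand (R : realType) (N : nat) (eta : networkA R N)
    (i : 'I_(net_size eta)) (z : R) : 'cV[R]_N :=
  subnet_eval (@net_act R N eta) (net_subnet i)
    (const_mx ((-1) ^+ net_sign i * z)).

Definition net_eval (R : realType) (N : nat) (eta : networkA R N) (z : R) :
    'cV[R]_N :=
  \sum_(i < net_size eta) net_summand i z.

Coercion net_eval : networkA >-> Funclass.

Definition EMVar (R : realType) (N : nat) (eta : networkA R N) (U : set R) :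
    'cV[R]_N :=
  \sum_(i < net_size eta)
    \col_(j < N) (sup [set net_summand i z j ord0 | z in U]
                  - inf [set net_summand i z j ord0 | z in U]).

Definition vintegral (R : realType) (N : nat) (D : set R)
    (f : R -> 'cV[R]_N) : 'cV[R]_N :=
  \col_(j < N) Rintegral (@lebesgue_measure R) D (fun s => f s j ord0).

Definition vintegrable (R : realType) (N : nat) (D : set R)
    (f : R -> 'cV[R]_N) : Prop :=
  forall j : 'I_N,
    (@lebesgue_measure R).-integrable D (fun s => (f s j ord0)%:E).

(* Joint Borel measurability on [0, T] x R^N, for the sigma-algebras generated
   by the open sets. *)
Definition borel_rhs (R : realType) (N : nat) (T : R)
    (F : R -> 'cV[R]_N -> 'cV[R]_N) : Prop :=
  @measurable_fun _ _
    (g_sigma_algebraType (@open (R * 'cV[R]_N)%type))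
    (g_sigma_algebraType (@open 'cV[R]_N))
    (`[0, T] `*` setT) (fun p => F p.1 p.2).

Definition bounded_rhs (R : realType) (N : nat) (T : R)
    (F : R -> 'cV[R]_N -> 'cV[R]_N) : Prop :=
  forall B : set (R * 'cV[R]_N),
    B `<=` `[0, T] `*` setT -> bounded_set B ->
    bounded_set [set F p.1 p.2 | p in B].

(* Smooth functions whose support is a compact subset of ]0, T[. *)
Definition test_function (R : realType) (T : R) (phi : R -> R) : Prop :=
  (forall n x, derivable (derive1n n phi) x 1) /\
  exists a b : R,
    [/\ 0 < a, b < T & forall x, x \notin `[a, b] -> phi x = 0].

(* W^{1,1}([0, T]; R^N) by weak derivatives; [y] is a function, that is, a
   chosen representative, and only its values on [0, T] matter. *)
Definition sobolev11 (R : realType) (N : nat) (T : R) (y : R -> 'cV[R]_N) :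
    Prop :=
  vintegrable `[0, T] y /\
  exists2 g : R -> 'cV[R]_N, vintegrable `[0, T] g &
    forall phi : R -> R, test_function T phi ->
      vintegral `[0, T] (fun s => derive1 phi s *: y s) =
      - vintegral `[0, T] (fun s => phi s *: g s).

(* The integrability clause makes the existence of the integral explicit:
   [vintegral] is a total operator. *)
Definition solution (R : realType) (N : nat) (T : R)
    (F : R -> 'cV[R]_N -> 'cV[R]_N) (y0 : 'cV[R]_N) (y : R -> 'cV[R]_N) :
    Prop :=
  [/\ sobolev11 T y,
      vintegrable `[0, T] (fun s => F s (y s)) &
      forall t, 0 <= t <= T ->
        y t = vintegral `[0, t] (fun s => F s (y s)) + y0].

Definition L1_cvg (R : realType) (N : nat) (T : R) (f : nat -> R -> 'cV[R]_N)
    (y : R -> 'cV[R]_N) : Prop :=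
  (\int[@lebesgue_measure R]_(s in `[0%R, T]) (enorm (f n s - y s))%:E)%E
    @[n --> \oo] --> 0%E.

(* A quadrature family, indexed by the tolerance: it maps an integrand and the
   end points of an interval to an approximate integral. *)
Definition quadrature_for (R : realType) (N : nat) (T : R)
    (F : R -> 'cV[R]_N -> 'cV[R]_N)
    (I : R -> (R -> 'cV[R]_N) -> R -> R -> 'cV[R]_N) : Prop :=
  forall tol : R, 0 < tol ->
  forall (eta : networkA R N) (a b : R), 0 <= a -> a <= b -> b <= T ->
    enorm (I tol (fun s => F s (eta s)) a b
           - vintegral `[a, b] (fun s => F s (eta s))) <= tol.

(* A partition 0 = t_0 < ... < t_{K_t} = T is encoded as in [itv_partition], by
   the list [t_1; ...; t_{K_t}]; hence K_t is its size. *)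
Definition node (R : realType) (T : R) (t : seq R) (k : nat) : R :=
  nth T (0 :: t) k.

Definition admissible_partition (R : realType) (N : nat) (T : R)
    (F : R -> 'cV[R]_N -> 'cV[R]_N) (eps : R) (eta : networkA R N)
    (t : seq R) : Prop :=
  itv_partition 0 T t /\
  forall k, (k < size t)%N ->
    (forall j, EMVar eta `[node T t k, node T t k.+1] j ord0 <= eps) /\
    ((\int[@lebesgue_measure R]_(s in `[node T t k, node T t k.+1])
        (enorm (F s (eta s)))%:E <= eps%:E)%E \/
     node T t k.+1 - node T t k <= eps).

Definition Loss (R : realType) (N : nat) (T : R)
    (F : R -> 'cV[R]_N -> 'cV[R]_N) (y0 : 'cV[R]_N)
    (I : R -> (R -> 'cV[R]_N) -> R -> R -> 'cV[R]_N) (M eps : R)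
    (eta : networkA R N) (t : seq R) : R :=
  \sum_(k < size t)
     enorm (eta (node T t k.+1) - eta (node T t k)
            - I (eps / (size t)%:R) (fun s => F s (eta s))
                (node T t k) (node T t k.+1))
  + enorm (eta 0 - y0)
  + Num.max 0 (enorm (EMVar eta `[0, T]) - M).

(* Main.v *)
Require Import Defs.
From HB Require Import structures.
From mathcomp Require Import all_boot all_order all_algebra.
From mathcomp Require Import all_classical all_reals all_analysis.
From mathcomp Require Import measurable_realfun ring lra.

Set Implicit Arguments.
Unset Strict Implicit.
Unset Printing Implicit Defensive.

Import Order.TTheory GRing.Theory Num.Theory.
Import numFieldNormedType.Exports.

Local Open Scope classical_set_scope.
Local Open Scope ring_scope.

(** Let [P(eta)(s) = y0 + int_0^s F(r, eta(r)) dr] be the Picard operator. The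
    loss adds up the residuals of the discretized equation [eta = P(eta)] over
    the cells of the partition. They telescope, and inside a cell neither the
    network nor the integral moves by more than a multiple of [eps]. Hence
    [eta_n - P(eta_n)] is at most [Loss_n + (3 + C) * eps_n] uniformly on [0, T]
    ([net_integral_equation]), where [C] bounds [F] along the networks. Such a
    constant exists because the loss also controls the initial value and the
    total variation, so that the networks are uniformly bounded
    ([net_le_Loss], [bounded_rhs_box]).

    The functions [P(eta_n)] are bounded and [C]-Lipschitz, and therefore have a
    uniformly convergent subsequence ([lipschitz_uniform_subsequence]). The
    networks converge uniformly to the same limit [y] along this subsequence.
    As [F] is continuous in its second argument, dominated convergence gives
    [P(eta_n) -> P(y)], so [y = P(y)] ([uniform_subsequence]). Uniform
    convergence implies convergence in [L^1] ([uniform_L1_cvg]). The equation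
    [y = P(y)] also puts [y] into [W^{1,1}], with weak derivative [F(s, y(s))]
    ([sobolev11_primitive]).

    Under uniqueness every subsequence has a further subsequence converging to
    the same limit, so the whole sequence converges
    ([L1_cvg_of_subsequences]). *)

(** * Monotonicity and oscillation of networks *)

(** Affine maps with nonnegative matrices and the activation are monotone, and
    so are their compositions. *)
Lemma subnet_eval_homo (R : realType) (N L m : nat) (sigma : R -> R)
    (f : subnet R N L m) :
  {homo sigma : x y / x <= y} -> subnet_nneg f ->
  forall z z' : 'cV[R]_m, (forall i, z i ord0 <= z' i ord0) ->
  forall j, subnet_eval sigma f z j ord0 <= subnet_eval sigma f z' j ord0.
Proof.
move=> sigma_homo.
have affine_homo p q (A : 'M[R]_(p, q)) (b : 'cV[R]_p) (z z' : 'cV[R]_q) :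
    (forall i j, 0 <= A i j) -> (forall i, z i ord0 <= z' i ord0) ->
    forall i, (A *m z + b) i ord0 <= (A *m z' + b) i ord0.
  move=> A0 zz' i; rewrite !mxE lerD2r.
  by apply: ler_sum => k _; exact: ler_wpM2l.
elim: f => [m' A b|L' m' p A b f ih] /=.
  by move=> A0 z z' zz' j; exact: affine_homo.
move=> [A0 f0] z z' zz'; apply: ih => // i.
by rewrite ![map_mx _ _ _ _]mxE; apply: sigma_homo; exact: affine_homo.
Qed.

(** The sign enters once through the argument and once through this
    multiplication, which turns the nonincreasing summands around. *)
Lemma net_summand_homo (R : realType) (N : nat) (eta : networkA R N)
    (i : 'I_(net_size eta)) (j : 'I_N) :
  {homo (fun z => (-1) ^+ net_sign i * net_summand i z j ord0) :
    x y / x <= y}.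
Proof.
move=> x y xy; rewrite /net_summand; have f0 := net_subnet_nneg i.
have act_homo := @net_act_nondecreasing _ _ eta.
case: (net_sign i); rewrite /= ?expr1 ?expr0 ?mulN1r ?mul1r.
  by rewrite lerN2; apply: subnet_eval_homo => // k; rewrite !mxE lerN2.
by apply: subnet_eval_homo => // k; rewrite !mxE.
Qed.

Lemma sup_inf_osc (R : realType) (f : R -> R) (b : bool) (U : set R)
    (l r x y : R) :
  {homo (fun z => (-1) ^+ b * f z) : x y / x <= y} ->
  U `<=` `[l, r] -> U x -> U y ->
  `|f x - f y| <= sup [set f z | z in U] - inf [set f z | z in U].
Proof.
move=> f_homo Ulr Ux Uy.
have [ub lb] : has_ubound [set f z | z in U] /\ has_lbound [set f z | z in U].
  case: b f_homo; rewrite /= ?expr1 ?expr0 => f_homo; split.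
  - exists (f l) => _ [z /Ulr + <-]; rewrite /= in_itv => /andP[lz _].
    by have := f_homo _ _ lz; rewrite !mulN1r lerN2.
  - exists (f r) => _ [z /Ulr + <-]; rewrite /= in_itv => /andP[_ zr].
    by have := f_homo _ _ zr; rewrite !mulN1r lerN2.
  - exists (f r) => _ [z /Ulr + <-]; rewrite /= in_itv => /andP[_ zr].
    by have := f_homo _ _ zr; rewrite !mul1r.
  - exists (f l) => _ [z /Ulr + <-]; rewrite /= in_itv => /andP[lz _].
    by have := f_homo _ _ lz; rewrite !mul1r.
have le z : U z -> inf [set f z | z in U] <= f z <= sup [set f z | z in U].
  by move=> Uz; rewrite ub_le_sup ?ge_inf//; exists z.
by have /andP[? ?] := le _ Ux; have /andP[? ?] := le _ Uy; rewrite ler_norml; lra.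
Qed.

Lemma net_evalE (R : realType) (N : nat) (eta : networkA R N) (z : R) j :
  eta z j ord0 = \sum_(i < net_size eta) net_summand i z j ord0.
Proof. by rewrite /net_eval summxE. Qed.

(** The estimated M-variation is the sum of the oscillations of the summands,
    hence it dominates the oscillation of their sum. *)
Lemma net_osc_le_EMVar (R : realType) (N : nat) (eta : networkA R N)
    (l r x y : R) (j : 'I_N) :
  x \in `[l, r] -> y \in `[l, r] ->
  `|eta x j ord0 - eta y j ord0| <= EMVar eta `[l, r] j ord0.
Proof.
move=> xlr ylr; rewrite !net_evalE -sumrB /EMVar summxE.
apply: le_trans (ler_norm_sum _ _ _) _; apply: ler_sum => i _; rewrite mxE.
exact: (@sup_inf_osc _ (fun z => net_summand i z j ord0) (net_sign i) _ l r
  _ _ (@net_summand_homo _ _ _ i j)).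
Qed.

Lemma measurable_net (R : realType) (N : nat) (eta : networkA R N)
    (D : set R) (j : 'I_N) :
  measurable D -> measurable_fun D (fun z => eta z j ord0).
Proof.
move=> mD; under eq_fun do rewrite net_evalE.
apply: measurable_sum => i.
rewrite (_ : (fun z => _) = (fun z => (-1) ^+ net_sign i *
    ((-1) ^+ net_sign i * net_summand i z j ord0))); last first.
  by apply/funext => z; rewrite mulrA -expr2 sqrr_sign mul1r.
apply: measurable_funM; first exact: measurable_cst.
apply: nondecreasing_measurable => // x y; exact: net_summand_homo.
Qed.

(** * The Euclidean norm and measurability along a curve *)

Lemma enorm_ge0 (R : realType) (n : nat) (v : 'cV[R]_n) : 0 <= enorm v.
Proof. exact: sqrtr_ge0. Qed.

Lemma coord_le_enorm (R : realType) (n : nat) (v : 'cV[R]_n) j :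
  `|v j ord0| <= enorm v.
Proof.
rewrite -sqrtr_sqr ler_wsqrtr// (bigD1 j)//= lerDl.
by apply: sumr_ge0 => i _; exact: sqr_ge0.
Qed.

Lemma enorm_le_sup (R : realType) (n : nat) (v : 'cV[R]_n) (c : R) :
  0 <= c -> (forall j, `|v j ord0| <= c) -> enorm v <= Num.sqrt n%:R * c.
Proof.
move=> c0 vc; rewrite -[X in _ * X]ger0_norm// -sqrtr_sqr -sqrtrM//.
rewrite ler_wsqrtr// mulr_natl -[X in _ *+ X]card_ord -sumr_const.
apply: ler_sum => j _; rewrite -real_normK ?num_real//.
by rewrite ler_pXn2r// ?nnegrE.
Qed.

Lemma measurable_enorm (R : realType) (n : nat) (D : set R)
    (v : R -> 'cV[R]_n) :
  measurable D -> (forall j, measurable_fun D (fun s => v s j ord0)) ->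
  measurable_fun D (fun s => enorm (v s)).
Proof.
move=> mD mv; apply: (measurableT_comp (f := @Num.sqrt R)).
  by apply: continuous_measurable_fun => x; exact: sqrt_continuous.
by apply: measurable_sum => j; exact: measurable_funX.
Qed.

(** The product of [R] with a space of columns is second countable: an open set
    is the union of the boxes with rational centres and radii that it
    contains. This is why measurability of the components suffices. *)
Lemma measurable_graph (R : realType) (N : nat) (D : set R)
    (h : R -> 'cV[R]_N) :
  measurable D -> (forall j, measurable_fun D (fun s => h s j ord0)) ->
  @measurable_fun _ _ _ (g_sigma_algebraType (@open (R * 'cV[R]_N)%type))
    D (fun s => (s, h s)).
Proof.
move=> mD mh.
pose box (i : rat * 'cV[rat]_N * nat) : set (R * 'cV[R]_N) :=
  [set p : R * 'cV[R]_N | `|p.1 - ratr i.1.1| < i.2.+1%:R^-1 /\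
           forall j, `|p.2 j ord0 - ratr (i.1.2 j ord0)| < i.2.+1%:R^-1].
have mbox i : measurable (D `&` (fun s => (s, h s)) @^-1` box i).
  have -> : D `&` (fun s => (s, h s)) @^-1` box i =
      (D `&` (fun s => s - ratr i.1.1) @^-1` ball (0 : R) i.2.+1%:R^-1) `&`
      \bigcap_(j in [set: 'I_N])
        (D `&` (fun s => h s j ord0 - ratr (i.1.2 j ord0)) @^-1`
                 ball (0 : R) i.2.+1%:R^-1).
    apply/seteqP; split => [s [Ds [/= si hi]]|s [[Ds /= si] hi]].
      by split=> [|j _]; split => //=; rewrite -ball_normE/= sub0r normrN.
    split=> //; split=> /= [|j].
      by move: si; rewrite -ball_normE/= sub0r normrN.
    by have [_] := hi j Logic.I; rewrite -ball_normE/= sub0r normrN.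
  apply: measurableI.
    by apply: (measurable_funB _ (measurable_cst _)) => //; exact: measurable_ball.
  apply: fin_bigcap_measurable => // j _.
  by apply: (measurable_funB (mh j) (measurable_cst _)) => //; exact: measurable_ball.
apply: (@measurability _ _ _ (g_sigma_algebraType (@open (R * 'cV[R]_N)%type)) _ _
  (@open (R * 'cV[R]_N)%type)) => // _ [U oU <-].
have -> : D `&` (fun s => (s, h s)) @^-1` U =
    \bigcup_i (if `[< box i `<=` U >]
               then D `&` (fun s => (s, h s)) @^-1` box i else set0).
  apply/seteqP; split => [s [Ds Us]|s [i _]]; last first.
    by case: asboolP => // iU [Ds /iU].
  have /nbhs_ballP[e /= e0 eU] : nbhs (s, h s) U by exact: open_nbhs_nbhs.
  have e20 : 0 < e / 2 by rewrite divr_gt0.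
  have [k _ /(_ k (leqnn k)) /= ke] := near_infty_natSinv_lt (PosNum e20).
  have rat_near x : exists q : rat, `|x - ratr q| < (k.+1%:R^-1 : R).
    have : 0 < k.+1%:R^-1 :> R by rewrite invr_gt0.
    move: k.+1%:R^-1 => r r0.
    have [|q] := @rat_in_itvoo R (x - r) (x + r); first by lra.
    by rewrite in_itv/= => /andP[? ?]; exists q; rewrite ltr_norml; lra.
  have [q sq] := rat_near s.
  have [a ha] := choice (fun j => rat_near (h s j ord0)).
  pose i := ((q, \col_j a j), k) : rat * 'cV[rat]_N * nat.
  exists i => //; rewrite ifT; first by split => //; split => //= j; rewrite mxE.
  apply/asboolP => -[x y]; rewrite /box/i /= => -[qx ay]; apply: eU; split.
    rewrite /ball /= /ball_ (le_lt_trans (ler_distD (ratr q) _ _))//.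
    rewrite (distrC _ x) (splitr e) ltrD//; first exact: lt_trans ke.
    exact: lt_trans ke.
  split => // l m; have -> : m = ord0 by exact: ord1.
  rewrite /ball /= /ball_.
  rewrite (le_lt_trans (ler_distD (ratr (a l)) _ _))//.
  rewrite (distrC _ (y l ord0)) (splitr e) ltrD//.
    exact: lt_trans (ha l) ke.
  by have := ay l; rewrite mxE => /lt_trans; apply.
apply: countable_bigcupT_measurable => // i; case: ifP => //.
Qed.

(** This gives a meaning to the integrals of the right-hand side along a
    network. *)
Lemma measurable_rhs_comp (R : realType) (N : nat) (T : R)
    (F : R -> 'cV[R]_N -> 'cV[R]_N) (h : R -> 'cV[R]_N) :
  borel_rhs T F ->
  (forall j, measurable_fun `[0, T] (fun s => h s j ord0)) ->
  forall j, measurable_fun `[0, T] (fun s => F s (h s) j ord0).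
Proof.
move=> mF mh j.
have mD : measurable (`[0, T] : set R) by exact: measurable_itv.
have mX : @measurable _ (g_sigma_algebraType (@open (R * 'cV[R]_N)%type))
    (`[0, T] `*` setT).
  rewrite -[X in measurable X]setCK; apply: measurableC.
  apply: sub_sigma_algebra; apply: closed_openC.
  rewrite setXT; apply: preimage_closed; last exact: itv_closed.
  by move=> x _; exact: cvg_fst.
have mcomp := @measurable_comp _ _ _ _ _ _ _ _ _ _ mX _ mF
  (measurable_graph mD mh).
have mcoord : @measurable_fun _ _ (g_sigma_algebraType (@open 'cV[R]_N)) R
    setT (fun v => v j ord0).
  apply: (@measurability _ _ (g_sigma_algebraType (@open 'cV[R]_N)) _ _ _ _
    (RGenOpens.measurableE R)).
  move=> _ [_ [a [b ->] <-]]; rewrite setTI; apply: sub_sigma_algebra.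
  move/continuousP: (@coord_continuous R N 1 j ord0); apply.
  exact: interval_open.
apply: (measurableT_comp mcoord); apply: mcomp.
by move=> _ [s Ds <-].
Qed.

(** * Bounded integrands and their primitives *)

Lemma bounded_rhs_box (R : realType) (N : nat) (T : R)
    (F : R -> 'cV[R]_N -> 'cV[R]_N) (B : R) :
  bounded_rhs T F ->
  exists2 C, 0 <= C &
    forall s (v : 'cV[R]_N), 0 <= s <= T -> (forall j, `|v j ord0| <= B) ->
      forall j, `|F s v j ord0| <= C.
Proof.
have mx_bound (v : 'cV[R]_N) c : 0 <= c ->
    `|v| <= c <-> forall j, `|v j ord0| <= c.
  move=> c0; rewrite (_ : `|v| = mx_norm v)// mx_normrE; split => [/bigmax_leP[_ vc] j|vc].
    by have := vc (j, ord0); apply.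
  apply/bigmax_leP; split => // -[j k] _ /=.
  by rewrite (_ : k = ord0) ?vc//; exact: ord1.
pose box : set (R * 'cV[R]_N) :=
  [set p : R * 'cV[R]_N | 0 <= p.1 <= T /\ forall j, `|p.2 j ord0| <= B].
move=> /(_ box); case.
- by move=> p [pT _]; split => //=; rewrite in_itv.
- exists (Num.max `|T| `|B|); split; first exact: num_real.
  move=> c /ltW; rewrite ge_max => /andP[Tc Bc] p [/andP[p0 pT] pB] /=.
  have -> : `|p| = Num.max `|p.1| `|p.2| by [].
  rewrite ge_max; apply/andP; split.
    by rewrite ger0_norm// (le_trans pT)// (le_trans (ler_norm _)).
  apply/mx_bound => [|j]; first exact: le_trans Bc.
  exact: le_trans (pB j) (le_trans (ler_norm _) Bc).
- move=> c [_ cP].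
  (* The bound is only guaranteed strictly above [c]. *)
  exists (`|c| + 1); first by rewrite addr_ge0.
  move=> s v sT vB j; move: j; apply/mx_bound; first by rewrite addr_ge0.
  apply: (cP (`|c| + 1)); first by rewrite (le_lt_trans (ler_norm c))// ltrDl.
  by exists (s, v).
Qed.

Lemma bounded_integrable (R : realType) (a b C : R) (g : R -> R) :
  measurable_fun `[a, b] g -> (forall s, a <= s <= b -> `|g s| <= C) ->
  (@lebesgue_measure R).-integrable `[a, b] (EFin \o g).
Proof.
move=> mg gC; apply: measurable_bounded_integrable => //.
  by rewrite /= lebesgue_measure_itv/=; case: ifP; rewrite ltry.
exists C; split; first exact: num_real.
by move=> c /ltW Cc s; rewrite /= in_itv => /gC gs; exact: le_trans Cc.
Qed.

Lemma Rintegral_itv_sub (R : realType) (T a b : R) (g : R -> R) :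
  (@lebesgue_measure R).-integrable `[0, T] (EFin \o g) ->
  0 <= a -> a <= b -> b <= T ->
  Rintegral (@lebesgue_measure R) `[0, b] g -
  Rintegral (@lebesgue_measure R) `[0, a] g =
  Rintegral (@lebesgue_measure R) `[a, b] g.
Proof.
move=> ig a0 ab bT.
have igb : (@lebesgue_measure R).-integrable `[0, b] (EFin \o g).
  by apply: integrableS ig => //; apply: subset_itvl; rewrite bnd_simp.
rewrite Rintegral_itvB ?bnd_simp// Rintegral_itv_obnd_cbnd//.
by apply: integrableS igb => //; apply: subset_itvr; rewrite bnd_simp.
Qed.

Lemma abs_Rintegral_le (R : realType) (a b C : R) (g : R -> R) :
  a <= b -> measurable_fun `[a, b] g ->
  (forall s, a <= s <= b -> `|g s| <= C) ->
  `|Rintegral (@lebesgue_measure R) `[a, b] g| <= C * (b - a).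
Proof.
move=> ab mg gC; have ig := bounded_integrable mg gC.
apply: le_trans (le_normr_Rintegral _ ig) _ => //.
have -> : C * (b - a) = Rintegral (@lebesgue_measure R) `[a, b] (cst C).
  rewrite Rintegral_cst//= lebesgue_measure_itv/= lte_fin.
  case: ltP => //= ba; have -> : a = b by apply/le_anti/andP.
  by rewrite subrr.
apply: le_Rintegral => //.
- by move/integrable_norm: ig.
- by apply: (@bounded_integrable _ _ _ `|C|) => //; exact: measurable_cst.
Qed.

(** The increments telescope up to the last node before [s], and the
    oscillation accounts for the cell that contains [s]. *)
Lemma partition_estimate (R : realType) (T : R) (t : seq R) (D : R -> R)
    (delta : nat -> R) (osc : R) :
  itv_partition 0 T t -> 0 <= osc -> (forall k, 0 <= delta k) ->
  (forall k, (k < size t)%N ->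
     `|D (node T t k.+1) - D (node T t k)| <= delta k) ->
  (forall k s, (k < size t)%N -> node T t k <= s <= node T t k.+1 ->
     `|D s - D (node T t k)| <= osc) ->
  forall s, 0 <= s <= T -> `|D s - D 0| <= \sum_(k < size t) delta k + osc.
Proof.
move=> tT osc0 delta0 Dnode Dcell s /andP[s0 sT].
have Dnode0 k : (k <= size t)%N ->
    `|D (node T t k) - D 0| <= \sum_(i < k) delta i.
  elim: k => [_|k ih kt]; first by rewrite /node/= subrr normr0 big_ord0.
  rewrite big_ord_recr/= addrC; apply: le_trans (lerD (Dnode k kt) (ih (ltnW kt))).
  by rewrite (le_trans _ (ler_normD _ _))// addrA subrK.
suff Dle k : (k <= size t)%N -> s <= node T t k ->
    `|D s - D 0| <= \sum_(i < k) delta i + osc.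
  by apply: Dle => //; rewrite /node (itv_partition_nth_size _ tT).
elim: k => [_|k ih kt].
  rewrite /node/= => s0'; have -> : s = 0 by apply/le_anti/andP.
  by rewrite subrr normr0 big_ord0 add0r.
move=> sk1; have [sk|/ltW ks] := leP s (node T t k).
  rewrite (le_trans (ih (ltnW kt) sk))// lerD2r big_ord_recr/= lerDl.
  exact: delta0.
rewrite -(subrKA (D (node T t k))) (le_trans (ler_normD _ _))// addrC.
rewrite lerD//; last by apply: Dcell; rewrite ?ks.
rewrite (le_trans (Dnode0 _ (ltnW kt)))// big_ord_recr/= lerDl.
exact: delta0.
Qed.

(** * The approximate integral equation of one network *)

(** In a cell of the partition only the integral over the whole cell is
    controlled, while the estimate is needed up to an interior point. *)
Lemma abs_Rintegral_le_dominating (R : realType) (a b c e : R) (g f : R -> R) :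
  b <= c ->
  (@lebesgue_measure R).-integrable `[a, b] (EFin \o g) ->
  measurable_fun `[a, c] f -> (forall s, `|g s| <= f s) ->
  (\int[@lebesgue_measure R]_(s in `[a, c]) (f s)%:E <= e%:E)%E ->
  `|Rintegral (@lebesgue_measure R) `[a, b] g| <= e.
Proof.
move=> bc ig mf gf fe; rewrite -lee_fin EFin_normr_Rintegral//.
have sub : `[a, b] `<=` `[a, c] by apply: subset_itvl; rewrite bnd_simp.
have f0 s : (0 <= (f s)%:E)%E by rewrite lee_fin (le_trans _ (gf s)).
have [mg _] := integrableP _ _ _ ig.
apply: le_trans (le_abse_integral _ _ mg) _ => //.
apply: le_trans fe; apply: (@le_trans _ _
  (\int[@lebesgue_measure R]_(s in `[a, b]) (f s)%:E)%E).
  apply: ge0_le_integral => //.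
  - by apply: measurableT_comp.
  - by apply/measurable_EFinP; exact: measurable_funS mf.
  - by move=> s _; rewrite lee_fin.
by apply: ge0_subset_integral => //; exact/measurable_EFinP.
Qed.

(** The residuals that the loss adds up are those of the discretized integral
    equation, so they telescope, at the price of the quadrature errors, whose
    sum is at most [eps]. Inside a cell, the network moves by at most [eps]
    because of the estimated M-variation, and the integral by at most
    [eps] or [C * eps], according to the alternative in the choice of the
    partition. *)
Lemma net_integral_equation (R : realType) (N : nat) (T : R) (y0 : 'cV[R]_N)
    (F : R -> 'cV[R]_N -> 'cV[R]_N)
    (I : R -> (R -> 'cV[R]_N) -> R -> R -> 'cV[R]_N) (M eps C : R)
    (eta : networkA R N) (t : seq R) :
  0 < T -> 0 < eps -> 0 <= C ->
  quadrature_for T F I -> admissible_partition T F eps eta t ->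
  (forall j, measurable_fun `[0, T] (fun s => F s (eta s) j ord0)) ->
  (forall s j, 0 <= s <= T -> `|F s (eta s) j ord0| <= C) ->
  forall s j, 0 <= s <= T ->
  `|eta s j ord0 -
    (y0 + vintegral `[0, s] (fun r => F r (eta r))) j ord0| <=
  Loss T F y0 I M eps eta t + (3 + C) * eps.
Proof.
move=> T0 eps0 C0 quad [tT adm] mF FC s j sT.
pose g r := F r (eta r) j ord0.
have ig : (@lebesgue_measure R).-integrable `[0, T] (EFin \o g).
  by apply: (bounded_integrable (mF j)) => r; exact: FC.
pose D r := eta r j ord0 - Rintegral (@lebesgue_measure R) `[0, r] g.
have DE r : D r = eta r j ord0 - vintegral `[0, r] (fun r => F r (eta r)) j ord0.
  by rewrite /D /vintegral mxE.
have DB a b : 0 <= a -> a <= b -> b <= T ->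
    D b - D a = eta b j ord0 - eta a j ord0 -
      Rintegral (@lebesgue_measure R) `[a, b] g.
  by move=> a0 ab bT; rewrite -(Rintegral_itv_sub ig)// /D; ring.
have t_gt0 : (0 < size t)%N.
  by case: t tT {adm} => // /itv_partition_nil T0E; rewrite -T0E ltxx in T0.
have K0 : 0 < (size t)%:R :> R by rewrite ltr0n.
have node_ge0 k : (k <= size t)%N -> 0 <= node T t k.
  by move=> kt; exact: itv_partition_nth_ge tT.
have node_leT k : (k <= size t)%N -> node T t k <= T.
  by move=> kt; exact: itv_partition_nth_le tT.
pose resid k := enorm (eta (node T t k.+1) - eta (node T t k)
            - I (eps / (size t)%:R) (fun s => F s (eta s))
                (node T t k) (node T t k.+1)).
have node_le k : (k < size t)%N -> node T t k <= node T t k.+1.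
  move=> kt; apply/ltW; case: tT => + _.
  by move/(pathP T)/(_ _ kt).
have D0E : D 0 = eta 0 j ord0.
  by rewrite /D set_itv1 Rintegral_set1 subr0.
have := @partition_estimate _ T t D (fun k => resid k + eps / (size t)%:R)
  (eps + (1 + C) * eps) tT _ _ _ _ s sT.
have step : [/\ 0 <= eps + (1 + C) * eps,
  forall k, 0 <= resid k + eps / (size t)%:R,
  forall k, (k < size t)%N ->
    `|D (node T t k.+1) - D (node T t k)| <= resid k + eps / (size t)%:R &
  forall k s, (k < size t)%N -> node T t k <= s <= node T t k.+1 ->
     `|D s - D (node T t k)| <= eps + (1 + C) * eps].
  split.
  - by rewrite addr_ge0 ?mulr_ge0 ?addr_ge0// ltW.
  - by move=> k; rewrite addr_ge0 ?enorm_ge0// divr_ge0// ltW.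
  - move=> k kt; have kt' := ltnW kt.
    rewrite DB ?node_le ?node_ge0 ?node_leT//.
    set a := node T t k; set b := node T t k.+1.
    set J := I (eps / (size t)%:R) (fun s => F s (eta s)) a b.
    have -> : eta b j ord0 - eta a j ord0 -
        Rintegral (@lebesgue_measure R) `[a, b] g =
      (eta b - eta a - J) j ord0 +
      (J - vintegral `[a, b] (fun s => F s (eta s))) j ord0.
      by rewrite !mxE; ring.
    apply: le_trans (ler_normD _ _) _; apply: lerD; first exact: coord_le_enorm.
    apply: le_trans (coord_le_enorm _ _) _.
    by apply: quad; rewrite ?divr_gt0// ?node_le ?node_ge0 ?node_leT.
  - move=> k r kt /andP[kr rk]; have kt' := ltnW kt.
    have a0 := node_ge0 _ kt'; have bT := node_leT _ kt.
    have [EM cell] := adm k kt.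
    rewrite DB// ?(le_trans rk)//.
    apply: le_trans (ler_normB _ _) _; apply: lerD.
      apply: le_trans (EM j); apply: net_osc_le_EMVar; rewrite in_itv/= ?kr//.
      by rewrite lexx (le_trans kr).
    have mg a b : 0 <= a -> b <= T -> measurable_fun `[a, b] g.
      move=> a0' bT'; apply: measurable_funS (mF j) => //.
      by apply: subset_itv; rewrite bnd_simp.
    have gC x : node T t k <= x <= node T t k.+1 -> `|g x| <= C.
      by move=> /andP[kx xk]; apply: FC; rewrite (le_trans a0)//= (le_trans xk).
    have eC : 0 <= C * eps by rewrite mulr_ge0// ltW.
    rewrite mulrDl mul1r; case: cell => [cell|cell].
      apply: (@le_trans _ _ eps); last by rewrite lerDl.
      apply: (abs_Rintegral_le_dominating rk _ _ _ cell).
      - apply: integrableS ig => //; apply: subset_itv; rewrite bnd_simp//.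
        exact: le_trans bT.
      - apply: measurable_enorm => // i; apply: measurable_funS (mF i) => //.
        by apply: subset_itv; rewrite bnd_simp.
      - by move=> x; exact: coord_le_enorm.
    apply: (@le_trans _ _ (C * eps)); last by rewrite lerDr ltW.
    apply: le_trans (@abs_Rintegral_le _ _ _ C _ kr _ _) _.
    - by apply: mg => //; exact: le_trans bT.
    - by move=> x /andP[kx xr]; rewrite gC// kx (le_trans xr).
    - by rewrite ler_wpM2l// (le_trans _ cell)// lerD2r.
case: step => h1 h2 h3 h4 /(_ h1 h2 h3 h4).
have epsE : \sum_(k < size t) eps / (size t)%:R = eps.
  by rewrite sumr_const card_ord -[LHS]mulr_natr divfK ?gt_eqF.
rewrite big_split/= epsE.
rewrite D0E => hD.
have -> : eta s j ord0 -
    (y0 + vintegral `[0, s] (fun r => F r (eta r))) j ord0 =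
    D s - eta 0 j ord0 + (eta 0 - y0) j ord0.
  by rewrite DE !mxE; ring.
have he := coord_le_enorm (eta 0 - y0) j.
have hm : 0 <= Num.max 0 (enorm (EMVar eta `[0, T]) - M) by rewrite le_max lexx.
apply: le_trans (ler_normD _ _) _.
have := lerD hD he; rewrite /Loss; move=> /le_trans; apply.
by move: hm; rewrite -/resid; lra.
Qed.

(** The last two terms of the loss control the initial value and the
    variation, hence the range of the network. *)
Lemma net_le_Loss (R : realType) (N : nat) (T : R) (y0 : 'cV[R]_N)
    (F : R -> 'cV[R]_N -> 'cV[R]_N)
    (I : R -> (R -> 'cV[R]_N) -> R -> R -> 'cV[R]_N) (M eps : R)
    (eta : networkA R N) (t : seq R) s j :
  0 <= s <= T ->
  `|eta s j ord0| <= enorm y0 + M + 2 * Loss T F y0 I M eps eta t.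
Proof.
move=> /andP[s0 sT].
have osc : `|eta s j ord0 - eta 0 j ord0| <= enorm (EMVar eta `[0, T]).
  apply: le_trans (le_trans (ler_norm _) (coord_le_enorm _ j)).
  by apply: net_osc_le_EMVar; rewrite in_itv/= ?s0 ?lexx// (le_trans s0).
have start : `|eta 0 j ord0 - y0 j ord0| <= enorm (eta 0 - y0).
  by apply: le_trans (coord_le_enorm _ j); rewrite !mxE.
have init := coord_le_enorm y0 j.
have tri : `|eta s j ord0| <= `|eta s j ord0 - eta 0 j ord0| +
    `|eta 0 j ord0 - y0 j ord0| + `|y0 j ord0|.
  rewrite -[X in `|X| <= _](subrK (eta 0 j ord0)) (le_trans (ler_normD _ _))//.
  rewrite -addrA lerD2l -[X in `|X| <= _](subrK (y0 j ord0)).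
  exact: ler_normD.
rewrite /Loss; set S := \sum_(k < _) _.
have S0 : 0 <= S by apply: sumr_ge0 => k _; exact: enorm_ge0.
have e0 := enorm_ge0 (eta 0 - y0).
have m0 : 0 <= Num.max 0 (enorm (EMVar eta `[0, T]) - M).
  by rewrite le_max lexx.
have m1 : enorm (EMVar eta `[0, T]) - M <=
    Num.max 0 (enorm (EMVar eta `[0, T]) - M) by rewrite le_max lexx orbT.
by move: S0 e0 m0 m1 tri init start osc; clearbody S; lra.
Qed.

(** * Compactness of equi-Lipschitz sequences *)

Lemma exists_subsequence (P : nat -> nat -> Prop) :
  (forall k m, exists2 n, (m <= n)%N & P k n) ->
  exists2 phi : nat -> nat, {homo phi : m n / (m < n)%N} &
    forall k, P k (phi k).
Proof.
move=> ex.
have /choice[f fP] : forall km : nat * nat,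
    exists n, (km.2 <= n)%N /\ P km.1 n.
  by move=> [k m]; have [n] := ex k m; exists n.
pose fix phi k := if k is k'.+1 then f (k, (phi k').+1) else f (0, 0)%N.
exists phi; last first.
  case=> [|k]; first by have [] := fP (0, 0)%N.
  by have [] := fP (k.+1, (phi k).+1).
apply: (@homo_ltn _ phi (fun m n => m < n)%N) => [n m p|k].
  exact: ltn_trans.
by have [] := fP (k.+1, (phi k).+1).
Qed.

Lemma exists_finite_net (R : realType) (T delta : R) :
  0 < delta ->
  exists2 l : seq R, (forall g, g \in l -> 0 <= g <= T) &
    forall s, 0 <= s <= T -> exists2 g, g \in l & `|s - g| <= delta.
Proof.
move=> d0; exists [seq g <- [seq i%:R * delta |
    i <- iota 0 (Num.truncn (T / delta)).+1] | g <= T].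
  move=> g; rewrite mem_filter => /andP[gT /mapP[i _ gE]].
  by rewrite gT andbT gE mulr_ge0// ltW.
move=> s /andP[s0 sT]; have sd0 : 0 <= s / delta by rewrite divr_ge0// ltW.
have /andP[] := truncn_itv sd0; rewrite ler_pdivlMr// ltr_pdivrMr//.
set i := Num.truncn _ => ds sd.
exists (i%:R * delta); last first.
  rewrite ger0_norm ?subr_ge0// lerBlDl (le_trans (ltW sd))//.
  by rewrite -natr1 mulrDl mul1r.
rewrite mem_filter (le_trans ds sT) andTb; apply/mapP; exists i => //.
rewrite mem_iota/= add0n ltnS; apply: le_truncn.
by rewrite ler_pM2r ?invr_gt0.
Qed.

(** Instead of extracting diagonal subsequences, take a cluster point of the
    sequence in the product space, which is compact. It is a limit of members
    of the sequence on every finite set, and equi-Lipschitz continuity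
    upgrades closeness on a fine grid to uniform closeness. *)
Lemma lipschitz_uniform_subsequence (R : realType) (J : finType) (T B C : R)
    (x : nat -> R -> J -> R) :
  0 <= C ->
  (forall n s j, 0 <= s <= T -> `|x n s j| <= B) ->
  (forall n s s' j, 0 <= s <= T -> 0 <= s' <= T ->
     `|x n s j - x n s' j| <= C * `|s - s'|) ->
  exists2 phi : nat -> nat, {homo phi : m n / (m < n)%N} &
    exists y : R -> J -> R, forall k s j, 0 <= s <= T ->
      `|x (phi k) s j - y s j| <= k.+1%:R^-1.
Proof.
move=> C0 xB xC.
pose X := prod_topology (fun _ : R * J => R : topologicalType).
(* Compactness of the product needs a bound at every point, hence the value 0
   outside [0, T]. *)
pose xx n : X := fun p => if 0 <= p.1 <= T then x n p.1 p.2 else 0.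
have /= K_compact := @tychonoff (R * J)%type (fun=> R) (fun=> `[- `|B|, `|B|]%classic)
  (fun=> @segment_compact _ _ _).
have [|f [_ f_cluster]] := K_compact (xx @ \oo) _.
  exists 0%N => // n _ [s j] /=; rewrite in_itv/= -ler_norml /xx/=.
  by case: ifP => [/xB/le_trans|_]; [apply; exact: ler_norm|rewrite normr0].
have close_on (l : seq R) (e : R) m : 0 < e -> (forall g, g \in l -> 0 <= g <= T) ->
    exists2 n, (m <= n)%N &
      forall g j, g \in l -> `|x n g j - f (g, j)| < e.
  move=> e0 lT.
  have Vf : nbhs (f : X)
      [set h : X | forall g, g \in l -> forall j, ball (f (g, j) : R) e (h (g, j) : R)].
    elim: l {lT} => [|g l ih]; first by apply: filterS filterT.
    have Vg : nbhs (f : X) [set h : X | forall j, ball (f (g, j) : R) e (h (g, j) : R)].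
      apply: (@filter_forall _ _ _ _ (nbhs_filter (f : X))) => j.
      have pc := @proj_continuous (R * J)%type (fun=> R) (g, j) (f : X).
      exact: (pc _ (nbhsx_ballx (f (g, j) : R) e e0)).
    apply: filterS2 ih Vg => h hl hg g'; rewrite inE => /predU1P[->|/hl] //.
  have tail : (xx @ \oo) [set xx n | n in [set n | (m <= n)%N]].
    by exists m => // n mn; exists n.
  have [_ [[n mn <-] nf]] := f_cluster _ _ tail Vf.
  exists n => // g j gl; have := nf g gl j.
  by rewrite /ball/= /ball_ /xx/= lT// distrC.
have f_lip s s' j : 0 <= s <= T -> 0 <= s' <= T ->
    `|f (s, j) - f (s', j)| <= C * `|s - s'|.
  move=> sT s'T; apply/ler_addgt0Pl => e e0.
  have [||n _ nf] := close_on [:: s; s'] (e / 2) 0%N.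
  - by rewrite divr_gt0.
  - by move=> g; rewrite !inE => /orP[] /eqP->.
  have := nf s j; rewrite !inE eqxx => /(_ isT).
  have := nf s' j; rewrite !inE eqxx orbT => /(_ isT).
  have := xC n s s' j sT s'T.
  rewrite !ltr_norml !ler_norml => /andP[? ?] /andP[? ?] /andP[? ?].
  by apply/andP; split; lra.
have [|phi phi_homo phiP] := @exists_subsequence (fun k n =>
    forall s j, 0 <= s <= T -> `|x n s j - f (s, j)| <= k.+1%:R^-1); last first.
  by exists phi => //; exists (fun s j => f (s, j)).
move=> k m; have e0 : 0 < k.+1%:R^-1 :> R by rewrite invr_gt0.
move: k.+1%:R^-1 e0 => e e0 {k}.
(* Two Lipschitz errors and one error at a point of the grid, each at most
   [e / 3]; the summand 1 covers [C = 0]. *)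
pose delta := e / 3 / (C + 1).
have d0 : 0 < delta by rewrite !divr_gt0// ltr_wpDl.
have [l lT l_net] := exists_finite_net T d0.
have e30 : 0 < e / 3 by rewrite divr_gt0.
have [n mn nf] := close_on l (e / 3) m e30 lT.
exists n => // s j sT; have [g gl sg] := l_net s sT.
have Cd : C * `|s - g| <= e / 3.
  rewrite (le_trans (ler_wpM2l C0 sg))// /delta mulrCA ger_pMr//.
  by rewrite ler_pdivrMr ?mul1r ?lerDl// ltr_wpDl.
have gT := lT g gl.
have := le_trans (xC n s g j sT gT) Cd.
have := le_trans (f_lip s g j sT gT) Cd.
have := nf g j gl.
rewrite !ltr_norml !ler_norml => /andP[? ?] /andP[? ?] /andP[? ?].
by apply/andP; split; lra.
Qed.

(** * Weak derivative of a primitive *)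

(** Fubini on the triangle [0 <= r <= s <= T]. It replaces the integration by
    parts for differentiable functions, because the primitive of [g] is only
    absolutely continuous. *)
Lemma triangle_fubini (R : realType) (T K C : R) (u g : R -> R) :
  let mu := @lebesgue_measure R in
  measurable_fun `[0, T] u -> (forall s, 0 <= s <= T -> `|u s| <= K) ->
  measurable_fun `[0, T] g -> (forall s, 0 <= s <= T -> `|g s| <= C) ->
  Rintegral mu `[0, T] (fun s => u s * Rintegral mu `[0, s] g) =
  Rintegral mu `[0, T] (fun r => Rintegral mu `[r, T] u * g r).
Proof.
move=> mu mu_ uK mg gC.
pose D : set R := `[0, T]%classic.
have mD : measurable D by exact: measurable_itv.
have mU : measurable_fun setT (u \_ D) by apply/(measurable_restrictT _ mD).
have mG : measurable_fun setT (g \_ D) by apply/(measurable_restrictT _ mD).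
pose f (p : R * R) : R := (u \_ D) p.1 * (g \_ D) p.2 *
  \1_[set q : R * R | q.2 <= q.1] p.
have mf : measurable_fun setT f.
  apply: measurable_funM; first apply: measurable_funM.
  - exact: (measurableT_comp mU measurable_fst).
  - exact: (measurableT_comp mG measurable_snd).
  - apply: measurable_indic.
    rewrite (_ : [set _ | _] =
      setT `&` (fun q : R * R => q.2 <= q.1) @^-1` [set true]).
      exact: (measurable_fun_ler measurable_snd measurable_fst).
    by rewrite setTI; apply/seteqP; split.
have fE s r : f (s, r) =
    if [&& 0 <= r, r <= s & s <= T] then u s * g r else 0.
  rewrite /f indicE/= !patchE.
  have [/and3P[r0 rs sT]|] := boolP [&& _, _ & _].
    rewrite !mem_set ?mulr1//= /D/= in_itv/= ?r0 ?sT ?(le_trans r0)//.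
    by rewrite (le_trans rs).
  have [sD|] := boolP (s \in D); last by rewrite !mul0r.
  have [rD|] := boolP (r \in D); last by rewrite mulr0 mul0r.
  move: sD rD; rewrite !inE/D/= !in_itv/= => /andP[s0 ->] /andP[-> rT].
  by rewrite andbT/= => rs; rewrite memNset/= ?mulr0//; exact/negP.
have inner_r s : (\int[mu]_r (f (s, r))%:E)%E =
    (((fun s => (u s * Rintegral mu `[0, s] g)%:E) \_ D) s)%E.
  rewrite patchE; case: ifPn => [/set_mem|/negP sD]; last first.
    apply: integral0_eq => r _; rewrite fE; case: and3P => // -[r0 rs sT].
    by exfalso; apply: sD; rewrite inE/D/= in_itv/= (le_trans r0).
  rewrite /D/= in_itv/= => /andP[s0 sT].
  have ig : mu.-integrable `[0, s] (EFin \o g).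
    apply: (@bounded_integrable _ _ _ C).
      by apply: measurable_funS mg => //; apply: subset_itvl; rewrite bnd_simp.
    by move=> r /andP[r0 rs]; rewrite gC// r0 (le_trans rs).
  rewrite EFinM fineK; last exact: integrable_fin_num ig.
  rewrite -integralZl// integral_mkcond; apply: eq_integral => r _.
  rewrite fE patchE mem_setE in_itv/= sT andbT; case: ifP => //.
have inner_s r : (\int[mu]_s (f (s, r))%:E)%E =
    (((fun r => (Rintegral mu `[r, T] u * g r)%:E) \_ D) r)%E.
  rewrite patchE; case: ifPn => [/set_mem|/negP sD]; last first.
    apply: integral0_eq => s _; rewrite fE; case: and3P => // -[r0 rs sT].
    by exfalso; apply: sD; rewrite inE/D/= in_itv/= r0 (le_trans rs).
  rewrite /D/= in_itv/= => /andP[r0 rT].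
  have iu : mu.-integrable `[r, T] (EFin \o u).
    apply: (@bounded_integrable _ _ _ K).
      by apply: measurable_funS mu_ => //; apply: subset_itvr; rewrite bnd_simp.
    by move=> s /andP[rs sT]; rewrite uK// sT (le_trans r0).
  rewrite mulrC EFinM fineK; last exact: integrable_fin_num iu.
  rewrite -integralZl// [RHS]integral_mkcond; apply: eq_integral => s _.
  rewrite fE patchE mem_setE in_itv/= r0 /=; case: ifP => //.
  by rewrite mulrC.
have mDD : measurable (D `*` D) by exact: measurableX.
have fi : (mu \x mu)%E.-integrable setT (EFin \o f).
  have -> : EFin \o f = (EFin \o f) \_ (D `*` D).
    apply/funext => -[s r]; rewrite patchE; case: ifPn => // /negP sr.
    rewrite /= fE; case: ifP => // /and3P[r0 rs sT]; exfalso; apply: sr.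
    by rewrite inE; split; rewrite /D/= in_itv/= ?r0 ?sT ?(le_trans r0)// (le_trans rs).
  have := (@integrable_mkcond _ _ R (mu \x mu)%E (D `*` D) (EFin \o f) mDD).1.
  apply; apply: measurable_bounded_integrable => //.
  - have muD : (mu D < +oo)%E.
      by rewrite /mu/= lebesgue_measure_itv/=; case: ifP; rewrite ltry.
    apply: (@le_lt_trans _ _ (mu D * mu D)%E).
      by rewrite -(product_measure1E mu mu mD mD).
    by rewrite lte_mul_pinfty// ge0_fin_numE.
  - exact: measurable_funTS.
  - exists (`|K| * `|C|); split; first exact: num_real.
    move=> c /ltW KCc [s r] [/= sD rD]; rewrite (le_trans _ KCc)// fE.
    case: ifP => [/and3P[r0 rs sT]|_]; last by rewrite normr0 mulr_ge0.
    rewrite normrM ler_pM// (le_trans _ (ler_norm _))//.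
      by rewrite uK// sT (le_trans r0).
    by rewrite gC// r0 (le_trans rs).
have := Fubini fi.
under eq_integral do rewrite inner_r.
under [X in _ = X -> _]eq_integral do rewrite inner_s.
by rewrite -!integral_mkcond => fub; rewrite /Rintegral fub.
Qed.

Lemma Rintegral_derive1 (R : realType) (phi : R -> R) (a b : R) :
  (forall n x, derivable (derive1n n phi) x 1) -> a <= b ->
  Rintegral (@lebesgue_measure R) `[a, b] (derive1 phi) = phi b - phi a.
Proof.
move=> smooth; rewrite le_eqVlt => /predU1P[->|ab].
  by rewrite set_itv1 Rintegral_set1 subrr.
have cont n : continuous (derive1n n phi).
  by move=> x; apply: differentiable_continuous; exact/derivable1_diffP.
rewrite /Rintegral (@continuous_FTC2 _ _ phi)//.
- exact/continuous_subspaceT/(cont 1%N).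
- split => [x _||]; first exact: (smooth 0%N).
  + exact/cvg_at_right_filter/(cont 0%N).
  + exact/cvg_at_left_filter/(cont 0%N).
Qed.

(** The weak derivative of [y] is [g]: exchanging the order of integration
    in the integral of [phi'] against a primitive of [g] leaves the integral
    of [phi'] over [r, T], that is [- phi r], against [g r]. *)
Lemma sobolev11_primitive (R : realType) (N : nat) (T C : R)
    (y0 : 'cV[R]_N) (g y : R -> 'cV[R]_N) :
  0 < T ->
  (forall j, measurable_fun `[0, T] (fun s => g s j ord0)) ->
  (forall s j, 0 <= s <= T -> `|g s j ord0| <= C) ->
  (forall t, 0 <= t <= T -> y t = vintegral `[0, t] g + y0) ->
  sobolev11 T y.
Proof.
move=> T0 mg gC yE.
pose mu := @lebesgue_measure R.
pose P j s := Rintegral mu `[0, s] (fun r => g r j ord0).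
have ig j : mu.-integrable `[0, T] (EFin \o (fun s => g s j ord0)).
  by apply: (bounded_integrable (mg j)) => s; exact: gC.
have cP j : {within `[0, T], continuous (P j)}.
  exact: (parameterized_integral_continuous (ltW T0) (ig j)).
have yPE j s : 0 <= s <= T -> y s j ord0 = P j s + y0 j ord0.
  by move=> /yE ->; rewrite !mxE.
have integrable_cont (f : R -> R) : {within `[0, T], continuous f} ->
    mu.-integrable `[0, T] (EFin \o f).
  by move=> cf; apply: continuous_compact_integrable => //; exact: segment_compact.
split => [j|].
  have := @eq_integrable _ _ _ mu `[0, T]%classic (measurable_itv _)
    (EFin \o (P j \+ cst (y0 j ord0))) (fun s => (y s j ord0)%:E).
  apply; first by move=> s; rewrite inE/= in_itv/= => sT; rewrite yPE.
  apply: integrable_cont; apply: within_continuousD => //.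
  by apply: continuous_subspaceT => x; exact: cvg_cst.
exists g => [j|phi [smooth [a [b [a0 bT supp]]]]].
  exact: ig.
have phi0 : phi 0 = 0 by apply: supp; rewrite in_itv/= leNgt a0.
have phiT : phi T = 0 by apply: supp; rewrite in_itv/= [T <= b]leNgt bT andbF.
have cdphi : {within `[0, T], continuous (derive1 phi)}.
  apply: continuous_subspaceT => x; apply: differentiable_continuous.
  exact/derivable1_diffP/(smooth 1%N).
have idphi := integrable_cont _ cdphi.
have bounded_cont (f : R -> R) : {within `[0, T], continuous f} ->
    exists K, forall s, 0 <= s <= T -> `|f s| <= K.
  move=> cf.
  have := compact_bounded (continuous_compact cf (@segment_compact _ _ _)).
  move=> [c [_ cK]]; exists (c + 1) => s sT.
  by apply: (cK (c + 1)); [rewrite ltrDl|exists s => //=; rewrite in_itv].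
have [K dphiK] := bounded_cont _ cdphi.
have cphi : {within `[0, T], continuous phi}.
  apply: continuous_subspaceT => x; apply: differentiable_continuous.
  exact/derivable1_diffP/(smooth 0%N).
have [L phiL] := bounded_cont _ cphi.
have mdphi : measurable_fun `[0, T] (derive1 phi).
  by have [/measurable_EFinP] := integrableP _ _ _ idphi.
have cdphiP j : {within `[0, T], continuous (fun s => derive1 phi s * P j s)}.
  by move=> x; apply: cvgM; [exact: cdphi|exact: cP].
apply/colP => j; rewrite !mxE.
transitivity (Rintegral mu `[0, T]
    (fun s => derive1 phi s * P j s + y0 j ord0 * derive1 phi s)).
  apply: eq_Rintegral => s; rewrite inE/= in_itv/= => sT.
  by rewrite mxE yPE// mulrDr [_ * y0 _ _]mulrC.
rewrite RintegralD//=; last 2 first.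
- exact: integrable_cont.
- by apply: integrable_cont => x; apply: cvgM; [exact: cvg_cst|exact: cdphi].
rewrite RintegralZl// Rintegral_derive1 ?ltW// phi0 phiT subr0 mulr0 addr0.
rewrite (triangle_fubini mdphi dphiK (mg j) (gC^~ j)).
rewrite (_ : (fun s => (phi s *: g s) j ord0) =
  (fun s => phi s * g s j ord0)); last by apply/funext => s; rewrite mxE.
rewrite -mulN1r -RintegralZl//; last first.
  apply: (@bounded_integrable _ _ _ (`|L| * `|C|)).
    apply: measurable_funM; last exact: mg.
    by have [/measurable_EFinP] := integrableP _ _ _ (integrable_cont _ cphi).
  move=> s sT; rewrite normrM ler_pM// (le_trans _ (ler_norm _))//.
    exact: phiL.
  exact: gC.
apply: eq_Rintegral => r; rewrite inE/= in_itv/= => /andP[r0 rT].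
by rewrite Rintegral_derive1// phiT sub0r mulN1r mulNr.
Qed.

(** * Passage to the limit *)

Lemma subsequence_cvgny (phi : nat -> nat) :
  {homo phi : m n / (m < n)%N} -> phi n @[n --> \oo] --> \oo.
Proof.
move=> phi_homo; have ge n : (n <= phi n)%N.
  by elim: n => // n ih; apply: leq_ltn_trans ih _; exact: phi_homo.
by apply/cvgnyPge => m; exists m => // n /= mn; exact: leq_trans (ge n).
Qed.

Lemma cvg_col (R : realType) (N : nat) (v : nat -> 'cV[R]_N) (w : 'cV[R]_N) :
  (forall j, v n j ord0 @[n --> \oo] --> w j ord0) -> v n @[n --> \oo] --> w.
Proof.
move=> vw; apply/cvg_ballP => e e0.
have H : \forall n \near \oo, forall j, ball (w j ord0) e (v n j ord0).
  by apply: filter_forall => j; move/cvg_ballP: (vw j); apply.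
apply: filterS H => n vn; split => // i k.
by have -> : k = ord0 by exact: ord1.
Qed.

(** The approximate integral equation keeps the networks uniformly close to
    their images under the Picard operator, which are equi-Lipschitz because
    [F] is bounded along the networks. A uniform limit of these images along a
    subsequence is therefore also one of the networks, and dominated
    convergence passes to the limit under the integral sign. *)
Lemma uniform_subsequence (R : realType) (N : nat) (T : R) (y0 : 'cV[R]_N)
    (F : R -> 'cV[R]_N -> 'cV[R]_N)
    (I : R -> (R -> 'cV[R]_N) -> R -> R -> 'cV[R]_N) (eps : nat -> R) (M : R)
    (eta : nat -> networkA R N) (t : nat -> seq R) :
  0 < T -> borel_rhs T F -> (forall s, 0 <= s <= T -> continuous (F s)) ->
  bounded_rhs T F -> quadrature_for T F I ->
  (forall n, 0 < eps n) -> eps n @[n --> \oo] --> 0 ->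
  (forall n, admissible_partition T F (eps n) (eta n) (t n)) ->
  Loss T F y0 I M (eps n) (eta n) (t n) @[n --> \oo] --> 0 ->
  exists2 phi : nat -> nat, {homo phi : m n / (m < n)%N} &
    exists2 y : R -> 'cV[R]_N, solution T F y0 y &
      exists2 u : nat -> R, u n @[n --> \oo] --> 0 &
        forall n s j, 0 <= s <= T ->
          `|eta (phi n) s j ord0 - y s j ord0| <= u n.
Proof.
move=> T0 mF cF bF quad eps0 eps_cvg adm.
set loss := fun n => Loss T F y0 I M (eps n) (eta n) (t n) => loss_cvg.
have [n0 _ loss1] : \forall n \near \oo, loss n <= 1.
  exact: (cvgr_le _ loss_cvg _ ltr01).
pose B := enorm y0 + M + 2.
have [C C0 FB] := bounded_rhs_box B bF.
have etaB n s j : (n0 <= n)%N -> 0 <= s <= T -> `|eta n s j ord0| <= B.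
  move=> n0n sT; apply: le_trans (net_le_Loss y0 F I M (eps n) (eta n) (t n) j sT) _.
  by rewrite lerD2l -[leRHS]mulr1 ler_pM2l// loss1.
have mFeta n j : measurable_fun `[0, T] (fun s => F s (eta n s) j ord0).
  by apply: measurable_rhs_comp => // i; exact: measurable_net.
have FC n s j : (n0 <= n)%N -> 0 <= s <= T -> `|F s (eta n s) j ord0| <= C.
  by move=> n0n sT; apply: FB => // i; exact: etaB.
pose x n s j := (y0 + vintegral `[0, s] (fun r => F r (eta n r))) j ord0.
pose err n := loss n + (3 + C) * eps n.
have eta_x n s j : (n0 <= n)%N -> 0 <= s <= T ->
    `|eta n s j ord0 - x n s j| <= err n.
  move=> n0n sT; apply: net_integral_equation => // r i rT.
  exact: FC.
have err_cvg : err n @[n --> \oo] --> 0.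
  rewrite -[X in _ --> X]addr0 -[X in _ + X](mulr0 (3 + C)).
  by apply: cvgD => //; apply: cvgM => //; apply: cvg_cst.
have iF n j : (n0 <= n)%N -> (@lebesgue_measure R).-integrable `[0, T]
    (EFin \o (fun s => F s (eta n s) j ord0)).
  by move=> n0n; apply: (bounded_integrable (mFeta n j)) => s; exact: FC.
have xE n s j : x n s j = y0 j ord0 + Rintegral (@lebesgue_measure R) `[0, s]
    (fun r => F r (eta n r) j ord0) by rewrite /x !mxE.
have xLip' n a b j : (n0 <= n)%N -> 0 <= a -> a <= b -> b <= T ->
    `|x n b j - x n a j| <= C * (b - a).
  move=> n0n a0 ab bT; rewrite !xE opprD addrACA subrr add0r.
  rewrite (Rintegral_itv_sub (iF n j n0n))//; apply: abs_Rintegral_le => //.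
    by apply: measurable_funS (mFeta n j) => //; apply: subset_itv; rewrite bnd_simp.
  by move=> s /andP[a_s sb]; apply: FC; rewrite // (le_trans a0)//= (le_trans sb).
have xLip n a b j : (n0 <= n)%N -> 0 <= a <= T -> 0 <= b <= T ->
    `|x n a j - x n b j| <= C * `|a - b|.
  move=> n0n /andP[a0 aT] /andP[b0 bT]; have [ab|/ltW ba] := leP a b.
    by rewrite distrC (distrC a) [`|b - a|]ger0_norm ?subr_ge0//; exact: xLip'.
  by rewrite [`|a - b|]ger0_norm ?subr_ge0//; exact: xLip'.
have x0 n j : x n 0 j = y0 j ord0.
  by rewrite xE set_itv1 Rintegral_set1 addr0.
have xB n s j : (n0 <= n)%N -> 0 <= s <= T -> `|x n s j| <= enorm y0 + C * T.
  move=> n0n /andP[s0 sT]; rewrite -(subrK (x n 0 j) (x n s j)).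
  rewrite addrC (le_trans (ler_normD _ _))// lerD//.
    by rewrite x0; exact: coord_le_enorm.
  by rewrite (le_trans (xLip' n _ _ j n0n (lexx 0) s0 sT))// subr0 ler_wpM2l.
(* The bounds hold from index [n0] on, hence the shift of the sequence. *)
have [phi phi_homo [y xy]] := @lipschitz_uniform_subsequence R 'I_N T
  (enorm y0 + C * T) C (fun n => x (n0 + n)%N) C0
  (fun n s j => xB _ s j (leq_addr n n0))
  (fun n s s' j => xLip _ s s' j (leq_addr n n0)).
pose psi k := (n0 + phi k)%N.
have psi_homo : {homo psi : m n / (m < n)%N}.
  by move=> m n mn; rewrite ltn_add2l phi_homo.
have n0psi k : (n0 <= psi k)%N by exact: leq_addr.
have psi_cvg := subsequence_cvgny psi_homo.
pose u k := err (psi k) + k.+1%:R^-1.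
have u_cvg : u k @[k --> \oo] --> 0.
  rewrite -[X in _ --> X]addr0; apply: cvgD; last exact: cvg_harmonic.
  exact: cvg_comp psi_cvg err_cvg.
pose yv s : 'cV[R]_N := \col_j y s j.
have eta_y k s j : 0 <= s <= T -> `|eta (psi k) s j ord0 - yv s j ord0| <= u k.
  move=> sT; rewrite mxE -(subrKA (x (psi k) s j)).
  by rewrite (le_trans (ler_normD _ _))// lerD// ?eta_x// xy.
have eta_cvg s : 0 <= s <= T -> eta (psi k) s @[k --> \oo] --> yv s.
  move=> sT; apply: cvg_col => j; apply/cvgrPdist_le => e e0.
  have [m _ um] := cvgr_le _ u_cvg _ e0; exists m => // k /um uk.
  by rewrite distrC (le_trans (eta_y k s j sT)).
have F_cvg s j : 0 <= s <= T ->
    F s (eta (psi k) s) j ord0 @[k --> \oo] --> F s (yv s) j ord0.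
  move=> sT; have Fs := cvg_comp _ _ (eta_cvg s sT) (cF s sT (yv s)).
  exact: (cvg_comp _ _ Fs (@coord_continuous _ _ _ j ord0 (F s (yv s)))).
have dom t' j : 0 <= t' <= T ->
    (@lebesgue_measure R).-integrable `[0, t']
      (EFin \o (fun s => F s (yv s) j ord0)) /\
    Rintegral (@lebesgue_measure R) `[0, t']
      (fun s => F s (eta (psi k) s) j ord0) @[k --> \oo] -->
    Rintegral (@lebesgue_measure R) `[0, t'] (fun s => F s (yv s) j ord0).
  move=> /andP[t'0 t'T].
  have sub : `[0, t'] `<=` `[0, T] by apply: subset_itvl; rewrite bnd_simp.
  have inT s : `[0, t']%classic s -> 0 <= s <= T.
    by move=> /sub /=; rewrite in_itv.
  have mF' k : measurable_fun `[0, t'] (fun s => F s (eta (psi k) s) j ord0).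
    exact: (measurable_funS _ sub (mFeta (psi k) j)).
  have mFy : measurable_fun `[0, t'] (fun s => F s (yv s) j ord0).
    by apply: (measurable_fun_cvg mF') => s /inT; exact: F_cvg.
  have iC : (@lebesgue_measure R).-integrable `[0, t'] (EFin \o cst C).
    apply: (@bounded_integrable _ _ _ `|C|) => //; exact: measurable_cst.
  have [] := @dominated_convergence _ _ _ (@lebesgue_measure R) `[0, t']%classic
    (measurable_itv _) (fun k s => (F s (eta (psi k) s) j ord0)%:E)
    (fun s => (F s (yv s) j ord0)%:E) (EFin \o cst C) _ _ _ iC _.
  - by move=> k; apply/measurable_EFinP; exact: mF'.
  - by apply/measurable_EFinP; exact: mFy.
  - by apply: aeW => s /inT sT; apply/fine_cvgP; split;
      [exact: nearW|exact: F_cvg].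
  - by apply: aeW => s k /inT sT; rewrite /= lee_fin FC.
  move=> iFy _ cvg_int; split => //.
  apply: fine_cvg; rewrite fineK; first exact: cvg_int.
  exact: integrable_fin_num iFy.
have FyC s j : 0 <= s <= T -> `|F s (yv s) j ord0| <= C.
  move=> sT; apply/ler_addgt0Pl => e e0.
  have /cvgrPdist_le/(_ e e0)[k _ /(_ k (leqnn k)) /= Fk] := F_cvg s j sT.
  rewrite -(subrK (F s (eta (psi k) s) j ord0) (F s (yv s) j ord0)).
  by rewrite (le_trans (ler_normD _ _))// lerD// FC.
have ycE t' : 0 <= t' <= T ->
    yv t' = vintegral `[0, t'] (fun s => F s (yv s)) + y0.
  move=> t'T; apply/colP => j; rewrite [_ + y0]addrC.
  have to_int : x (psi k) t' j @[k --> \oo] -->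
      (y0 + vintegral `[0, t'] (fun s => F s (yv s))) j ord0.
    under eq_fun do rewrite xE; rewrite !mxE.
    by apply: cvgD; [exact: cvg_cst|have [] := dom t' j t'T].
  apply: cvg_unique to_int; first exact: Rhausdorff.
  apply/cvgrPdist_le => e e0; rewrite mxE.
  have [m _ hm] := cvgr_le _ (@cvg_harmonic R) _ e0; exists m => // k /hm ke.
  by rewrite distrC (le_trans (xy k _ j t'T)).
exists psi => //; exists yv; last by exists u.
have iFy : vintegrable `[0, T] (fun s => F s (yv s)).
  by move=> j; have [] := dom T j; rewrite ?lexx ?ltW.
split => //; apply: (sobolev11_primitive T0 _ FyC ycE) => j.
by have [/measurable_EFinP] := integrableP _ _ _ (iFy j).
Qed.

(** * Convergence in L^1 *)

Lemma uniform_L1_cvg (R : realType) (N : nat) (T : R)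
    (f : nat -> R -> 'cV[R]_N) (y : R -> 'cV[R]_N) (u : nat -> R) :
  0 < T ->
  (forall n j, measurable_fun `[0, T] (fun s => f n s j ord0)) ->
  (forall j, measurable_fun `[0, T] (fun s => y s j ord0)) ->
  u n @[n --> \oo] --> 0 ->
  (forall n s j, 0 <= s <= T -> `|f n s j ord0 - y s j ord0| <= u n) ->
  L1_cvg T f y.
Proof.
move=> T0 mf my u_cvg fy.
pose h n : \bar R := (Num.sqrt N%:R * `|u n| * T)%:E.
have h_cvg : h n @[n --> \oo] --> 0%E.
  apply/fine_cvgP; split; first exact: nearW.
  have : Num.sqrt N%:R * `|u n| * T @[n --> \oo] --> Num.sqrt N%:R * `|0 : R| * T.
    apply: cvgM; last exact: cvg_cst.
    by apply: cvgM; [exact: cvg_cst|exact: cvg_norm].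
  by rewrite normr0 mulr0 mul0r.
apply: (squeeze_cvge _ (cvg_cst 0%E) h_cvg); apply: nearW => n.
rewrite integral_ge0 => [|s _]; last by rewrite lee_fin enorm_ge0.
have -> : h n = (\int[@lebesgue_measure R]_(s in `[0%R, T])
    (cst (Num.sqrt N%:R * `|u n|)%:E) s)%E.
  by rewrite integral_cst//= lebesgue_measure_itv/= lte_fin T0 oppr0 addr0.
apply: ge0_le_integral => //.
- by move=> s _; rewrite lee_fin enorm_ge0.
- apply/measurable_EFinP; apply: measurable_enorm => // j.
  rewrite (_ : (fun s => _) = (fun s => f n s j ord0 - y s j ord0)).
    exact: measurable_funB.
  by apply/funext => s; rewrite !mxE.
- move=> s; rewrite /= in_itv/= => sT; rewrite lee_fin.
  apply: enorm_le_sup => // j; rewrite !mxE.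
  exact: le_trans (fy n s j sT) (ler_norm _).
Qed.

Lemma L1_cvg_subsequence (R : realType) (N : nat) (T : R) (y0 : 'cV[R]_N)
    (F : R -> 'cV[R]_N -> 'cV[R]_N)
    (I : R -> (R -> 'cV[R]_N) -> R -> R -> 'cV[R]_N) (eps : nat -> R) (M : R)
    (eta : nat -> networkA R N) (t : nat -> seq R) :
  0 < T -> borel_rhs T F -> (forall s, 0 <= s <= T -> continuous (F s)) ->
  bounded_rhs T F -> quadrature_for T F I ->
  (forall n, 0 < eps n) -> eps n @[n --> \oo] --> 0 ->
  (forall n, admissible_partition T F (eps n) (eta n) (t n)) ->
  Loss T F y0 I M (eps n) (eta n) (t n) @[n --> \oo] --> 0 ->
  exists2 phi : nat -> nat, {homo phi : m n / (m < n)%N} &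
    exists2 y : R -> 'cV[R]_N, solution T F y0 y &
      L1_cvg T (fun n => eta (phi n)) y.
Proof.
move=> T0 mF cF bF quad eps0 eps_cvg adm loss_cvg.
have [phi phi_homo [y sol_y [u u_cvg eta_y]]] :=
  uniform_subsequence T0 mF cF bF quad eps0 eps_cvg adm loss_cvg.
exists phi => //; exists y => //; apply: uniform_L1_cvg u_cvg eta_y => // [n j|j].
  exact: measurable_net.
have [[iy _] _ _] := sol_y.
by have [/measurable_EFinP] := integrableP _ _ _ (iy j).
Qed.

(** Otherwise the distance to [y] stays above a positive constant along some
    subsequence, which then has no subsequence converging to [y]. *)
Lemma L1_cvg_of_subsequences (R : realType) (N : nat) (T : R)
    (f : nat -> R -> 'cV[R]_N) (y : R -> 'cV[R]_N) :
  (forall psi : nat -> nat, {homo psi : m n / (m < n)%N} ->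
     exists phi : nat -> nat, L1_cvg T (fun n => f (psi (phi n))) y) ->
  L1_cvg T f y.
Proof.
rewrite /L1_cvg => sub.
pose a n : \bar R :=
  (\int[@lebesgue_measure R]_(s in `[0%R, T]) (enorm (f n s - y s))%:E)%E.
have a0 n : (0 <= a n)%E.
  by apply: integral_ge0 => s _; rewrite lee_fin enorm_ge0.
have a_fin n e : (a n < e%:E)%E -> a n \is a fin_num.
  by move=> an; rewrite ge0_fin_numE// (lt_trans an)// ltry.
have a_small e : 0 < e -> \forall n \near \oo, (a n < e%:E)%E.
  move=> e0; apply: contrapT => large.
  have [k m|psi psi_homo psi_large] :=
      @exists_subsequence (fun _ n => (e%:E <= a n)%E).
    apply: contrapT => small; apply: large; exists m => // n /= mn.
    by rewrite ltNge; apply/negP => an; apply: small; exists n.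
  have [phi /fine_cvgP[fin a_cvg]] := sub psi psi_homo.
  have [m1 _ fin1] := fin; have [m2 _ lt2] := cvgr_lt _ a_cvg _ e0.
  pose m := maxn m1 m2.
  have := lt2 m (leq_maxr _ _); have := fin1 m (leq_maxl _ _) => /= finm.
  rewrite -lte_fin fineK// => /lt_le_trans/(_ (psi_large (phi m))).
  by rewrite ltxx.
apply/fine_cvgP; split; first exact: filterS (fun n => @a_fin n 1) (a_small _ ltr01).
apply/cvgrPdist_lt => e e0; apply: filterS (a_small _ e0) => n an.
have an0 : 0 <= fine (a n) by exact: fine_ge0.
rewrite sub0r normrN ger0_norm// -lte_fin fineK//; exact: a_fin an.
Qed.

Theorem theoremC2 (R : realType) (N : nat) (T : R) (y0 : 'cV[R]_N)
    (F : R -> 'cV[R]_N -> 'cV[R]_N)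
    (I : R -> (R -> 'cV[R]_N) -> R -> R -> 'cV[R]_N)
    (eps : nat -> R) (M : R)
    (eta : nat -> networkA R N) (t : nat -> seq R) :
  0 < T ->
  borel_rhs T F ->
  (forall s, 0 <= s <= T -> continuous (F s)) ->
  bounded_rhs T F ->
  quadrature_for T F I ->
  (forall n, 0 < eps n) ->
  eps n @[n --> \oo] --> 0 ->
  0 < M ->
  (forall n, admissible_partition T F (eps n) (eta n) (t n)) ->
  Loss T F y0 I M (eps n) (eta n) (t n) @[n --> \oo] --> 0 ->
  (exists2 phi : nat -> nat, {homo phi : m n / (m < n)%N} &
     exists2 y : R -> 'cV[R]_N, solution T F y0 y &
       L1_cvg T (fun n => eta (phi n)) y) /\
  (forall y : R -> 'cV[R]_N, solution T F y0 y ->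
     (forall y' : R -> 'cV[R]_N, solution T F y0 y' ->
        forall s, 0 <= s <= T -> y' s = y s) ->
     L1_cvg T (fun n => eta n) y).
Proof.
move=> T0 mF cF bF quad eps0 eps_cvg _ adm loss_cvg.
split; first exact: L1_cvg_subsequence loss_cvg.
move=> y sol_y uniq; apply: L1_cvg_of_subsequences => psi psi_homo.
have psi_cvg := subsequence_cvgny psi_homo.
have [phi _ [y' sol_y' y'_cvg]] := L1_cvg_subsequence T0 mF cF bF quad
  (fun n => eps0 (psi n)) (cvg_comp _ _ psi_cvg eps_cvg)
  (fun n => adm (psi n)) (cvg_comp _ _ psi_cvg loss_cvg).
exists phi; move: y'_cvg; rewrite /L1_cvg; apply: cvg_trans.
apply: near_eq_cvg; apply: nearW => n; apply: eq_integral => s.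
by rewrite inE/= in_itv/= => sT; rewrite (uniq _ sol_y' s sT).
Qed.
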